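(* Let $G$ be a finite group and $H$ a normal subgroup of $G$. The following are equivalent: (1) the enhanced quotient graph $\mathcal{G}_H(G)$ is complete; (2) $G/H$ is cyclic; (3) the enhanced power graph $\mathcal{G}(G/H)$ is complete.
   Context: For a finite group $K$, the enhanced power graph $\mathcal{G}(K)$ is the simple graph with vertex set $K$ in which two distinct vertices $x,y$ are adjacent if there is $z\in K$ with $x,y\in\langle z\rangle$. For a finite group $G$ with a normal subgroup $H$, the enhanced quotient graph $\mathcal{G}_H(G)$ is the simple graph with vertex set $(G\setminus H)\cup\{e\}$, where $e$ is the identity of $G$, in which two distinct vertices $x,y$ are adjacent if $xH=yH$ or $xH,yH\in\langle zH\rangle$ for some $z\in G$. *)

(* Defs.v *)
From mathcomp Require Import all_boot all_fingroup all_solvable.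

Set Implicit Arguments.
Unset Strict Implicit.
Unset Printing Implicit Defensive.

Local Open Scope group_scope.

Record simple_graph (T : finType) := SimpleGraph {
  vertices : {set T};
  adj : rel T;
  adj_vertices : forall x y, adj x y -> (x \in vertices) && (y \in vertices);
  adj_irrefl : irreflexive adj;
  adj_sym : symmetric adj
}.

Definition complete_graph (T : finType) (S : simple_graph T) : Prop :=
  forall x y, x \in vertices S -> y \in vertices S -> x != y -> adj S x y.

Section EnhancedPowerGraph.

Variables (gT : finGroupType) (K : {group gT}).

Definition enhanced_power_adj : rel gT := fun x y =>
  [&& x \in K, y \in K, x != y
    & [exists z in K, (x \in <[z]>) && (y \in <[z]>)]].

Fact enhanced_power_adj_vertices x y :
  enhanced_power_adj x y -> (x \in K) && (y \in K).
Proof. by case/and4P=> -> ->. Qed.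

Fact enhanced_power_adj_irrefl : irreflexive enhanced_power_adj.
Proof. by move=> x; rewrite /enhanced_power_adj eqxx !andbF. Qed.

Fact enhanced_power_adj_sym : symmetric enhanced_power_adj.
Proof.
move=> x y; rewrite /enhanced_power_adj andbCA eq_sym; do 3!congr (_ && _).
by apply: eq_existsb => z; rewrite [(x \in _) && _]andbC.
Qed.

Definition enhanced_power_graph : simple_graph gT :=
  @SimpleGraph gT K _ (@enhanced_power_adj_vertices)
    enhanced_power_adj_irrefl enhanced_power_adj_sym.

End EnhancedPowerGraph.

Section EnhancedQuotientGraph.

Variables (gT : finGroupType) (G H : {group gT}).

Definition enhanced_quotient_vertices : {set gT} := (G :\: H) :|: [set 1].

(* When H <| G, [coset H x] is the element xH of G / H for every x in G.    *)
(* The projection [coset H] is only meaningful on 'N(H), so the graph below *)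
(* is meant to be used for H normal in G.                                   *)
Definition enhanced_quotient_adj : rel gT := fun x y =>
  [&& x \in enhanced_quotient_vertices, y \in enhanced_quotient_vertices,
      x != y
    & (coset H x == coset H y)
      || [exists z in G, (coset H x \in <[coset H z]>)
                           && (coset H y \in <[coset H z]>)]].

Fact enhanced_quotient_adj_vertices x y : enhanced_quotient_adj x y ->
  (x \in enhanced_quotient_vertices) && (y \in enhanced_quotient_vertices).
Proof. by case/and4P=> -> ->. Qed.

Fact enhanced_quotient_adj_irrefl : irreflexive enhanced_quotient_adj.
Proof. by move=> x; rewrite /enhanced_quotient_adj eqxx !andbF. Qed.

Fact enhanced_quotient_adj_sym : symmetric enhanced_quotient_adj.
Proof.
move=> x y; rewrite /enhanced_quotient_adj andbCA [x == y]eq_sym.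
rewrite [coset H x == _]eq_sym; do 3!congr (_ && _); congr (_ || _).
by apply: eq_existsb => z; rewrite [(coset H x \in _) && _]andbC.
Qed.

Definition enhanced_quotient_graph : simple_graph gT :=
  @SimpleGraph gT enhanced_quotient_vertices _ (@enhanced_quotient_adj_vertices)
    enhanced_quotient_adj_irrefl enhanced_quotient_adj_sym.

End EnhancedQuotientGraph.

(* Main.v *)
Require Import Defs.
From mathcomp Require Import all_boot all_fingroup all_solvable.

(** Completeness of either graph amounts to one condition on [G / H]: any two elements lie in a
    common cyclic subgroup. By [cyclic_pairwiseP] this means that [G / H] is cyclic. *)

(* Only the implication from pairwise to global cyclicity needs an argument:  *)
(* an element [z] of maximal order generates, since [z] and any other element *)
(* lie in a common cyclic subgroup, which by maximality is [<[z]>].           *)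
Lemma cyclic_pairwiseP (gT : finGroupType) (K : {group gT}) :
  cyclic K <->
  {in K &, forall x y, [exists z in K, (x \in <[z]>%g) && (y \in <[z]>%g)]}.
Proof.
split=> [/cyclicP[z defK] x y Kx Ky | pairK].
  by apply/exists_inP; exists z; rewrite -?defK ?Kx // defK cycle_id.
case: (@arg_maxnP _ 1%g [in K] (fun x => #[x]%g) (group1 K)) => z Kz maxz.
apply/cyclicP; exists z; apply/eqP; rewrite eqEsubset cycle_subG Kz andbT.
apply/subsetP=> x Kx.
have /exists_inP[w Kw /andP[xw zw]] := pairK x z Kx Kz.
have szw : <[z]>%g \subset <[w]>%g by rewrite cycle_subG.
suff /eqP-> : <[z]>%g == <[w]>%g by [].
by rewrite eqEcard szw; apply: maxz.
Qed.

Lemma complete_enhanced_power_graphP (gT : finGroupType) (K : {group gT}) :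
  complete_graph (enhanced_power_graph K) <-> cyclic K.
Proof.
split=> [complK | /cyclic_pairwiseP pairK x y /= Kx Ky nxy].
  apply/cyclic_pairwiseP => x y Kx Ky; have [<- | nxy] := eqVneq x y.
    by apply/exists_inP; exists x; rewrite ?cycle_id.
  by have /and4P[] := complK x y Kx Ky nxy.
by rewrite /enhanced_power_adj Kx Ky nxy pairK.
Qed.

(** Adjacency of distinct vertices depends only on their cosets, and representatives in [G] of
    nontrivial cosets are vertices. The trivial coset lies in every cyclic subgroup. *)
Lemma complete_enhanced_quotient_graphP (gT : finGroupType)
    (G H : {group gT}) :
  complete_graph (enhanced_quotient_graph G H) <-> cyclic (G / H)%g.
Proof.
have vertexG x : x \in enhanced_quotient_vertices G H -> x \in G.
  by rewrite !inE => /orP[/andP[] // | /eqP->].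
split=> [complGH | /cyclic_pairwiseP pairGH x y /= Vx Vy nxy].
  apply/cyclic_pairwiseP => _ _ /morphimP[x Nx Gx ->] /morphimP[y Ny Gy ->] /=.
  have Qx := mem_quotient H Gx; have Qy := mem_quotient H Gy.
  (* Equal cosets are split off: their adjacency may come from the first disjunct, which yields no
     [z]. *)
  have [-> | nexy] := eqVneq (coset H x) (coset H y).
    by apply/exists_inP; exists (coset H y); rewrite ?cycle_id.
  (* A representative of the trivial coset may fail to be a vertex, so completeness cannot be
     applied to it. *)
  have [-> | nex1] := eqVneq (coset H x) 1%g.
    by apply/exists_inP; exists (coset H y); rewrite ?group1 ?cycle_id.
  have [-> | ney1] := eqVneq (coset H y) 1%g.
    by apply/exists_inP; exists (coset H x); rewrite ?group1 ?cycle_id.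
  have vertex u : u \in G -> coset H u != 1%g ->
      u \in enhanced_quotient_vertices G H.
    by move=> Gu nu1; rewrite !inE Gu andbT (contra _ nu1) // => /coset_id->.
  have nxy : x != y by apply: contraNneq nexy => ->.
  have /and4P[_ _ _] := complGH x y (vertex x Gx nex1) (vertex y Gy ney1) nxy.
  rewrite (negPf nexy) => /exists_inP[z Gz xyz].
  by apply/exists_inP; exists (coset H z); first exact: mem_quotient.
(* The second disjunct holds even when the two cosets coincide. *)
rewrite /enhanced_quotient_adj Vx Vy nxy /=; apply/orP; right.
have /exists_inP[_ /morphimP[z _ Gz ->] xyz] :=
  pairGH _ _ (mem_quotient H (vertexG x Vx)) (mem_quotient H (vertexG y Vy)).
by apply/exists_inP; exists z.
Qed.

Theorem corollary3p3 (gT : finGroupType) (G H : {group gT}) (nsHG : (H <| G)%g) :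
  (complete_graph (enhanced_quotient_graph G H) <-> cyclic (G / H)%g) /\
  (cyclic (G / H)%g <-> complete_graph (enhanced_power_graph (G / H)%G)).
Proof.
split; first exact: complete_enhanced_quotient_graphP.
by apply: iff_sym; apply: complete_enhanced_power_graphP.
Qed.
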